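(* Let $\eta$ be a smooth skew-symmetric point $k$-form on a differential space $(M,\mathcal{C})$, and let $\mathcal{G}$ be a family of generators of the differential structure $\mathcal{C}$. Assume that: (i) there exists a finite open covering $\{U_i\}_{i\in I}$ ($I=\{1,\ldots,q\}$, $q\in\mathbb{N}$) of $M$ such that for any $i\in I$ there exist a number $m_i\in\mathbb{N}$, functions $\alpha_{i,j}^1,\ldots,\alpha_{i,j}^k\in\mathcal{G}$ for $j=1,\ldots,m_i$, and functions $\beta_{i,1},\ldots,\beta_{i,m_i}\in\mathcal{C}$ uniform with respect to the uniform structure $\mathcal{U}_{\mathcal{G}}$, such that $$\eta_{|U_i}=\sum_{j=1}^{m_i}\beta_{i,j|U_i}\,(d\alpha_{i,j}^1)_{|U_i}\wedge\cdots\wedge(d\alpha_{i,j}^k)_{|U_i};$$ (ii) there exists a smooth partition of unity $\{\gamma_i\}_{i\in I}$ subordinated to the covering $\{U_i\}_{i\in I}$ such that every $\gamma_i$, $i\in I$, is uniform with respect to $\mathcal{U}_{\mathcal{G}}$. Then for any smooth $n$-dimensional generalized cube $\varphi:D\to M$ such that $T\varphi:TD\to TM$ is uniform with respect to the uniform structure given on $TM$ by $\mathcal{T}\mathcal{G}_0$, the $k$-form $\varphi^*\eta$ is smooth on $D$ and can be extended to a $k$-form $\widetilde{\varphi^*\eta}$ continuous on $[0,1]^n$.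
   Context: A differential space $(M,\mathcal{C})$ is a nonempty set $M$ with a family $\mathcal{C}$ of real functions on $M$ (a differential structure) such that, with $M$ given the weakest topology making all functions of $\mathcal{C}$ continuous: (a) $\sigma(f_1,\ldots,f_r)\in\mathcal{C}$ for all $f_i\in\mathcal{C}$, $\sigma\in C^\infty(\mathbb{R}^r)$; (b) any function that near each point coincides with some element of $\mathcal{C}$ belongs to $\mathcal{C}$. $\mathcal{C}$ is generated by $\mathcal{G}$ if it is the smallest differential structure containing $\mathcal{G}$ (equivalently, $f\in\mathcal{C}$ iff locally $f=\sigma(g_1,\ldots,g_r)$ with $g_i\in\mathcal{G}$, $\sigma\in C^\infty(\mathbb{R}^r)$). For $A\subset M$, $\mathcal{C}_A$ is the structure on $A$ generated by restrictions of elements of $\mathcal{C}$. A map $F:(M,\mathcal{C})\to(N,\mathcal{D})$ is smooth if $f\circ F\in\mathcal{C}$ for all $f\in\mathcal{D}$. $T_mM$ is the space of linear maps $v:\mathcal{C}\to\mathbb{R}$ with $v(\alpha\beta)=\alpha(m)v(\beta)+\beta(m)v(\alpha)$; $TM=\bigsqcup_m T_mM$, $\pi:TM\to M$ the projection, $d\alpha(v)=v(\alpha)$. $TM$ has the structure $\mathcal{T}\mathcal{C}$ generated by $\{\alpha\circ\pi,\ d\alpha:\alpha\in\mathcal{C}\}$. $T^kM=\{(v_1,\ldots,v_k)\in (TM)^k:\pi(v_1)=\cdots=\pi(v_k)\}$ has the structure $\tau^k\mathcal{C}$ induced from the product structure on $(TM)^k$ (generated by the $f\circ\mathrm{pr}_i$,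 $f\in\mathcal{T}\mathcal{C}$). A point $k$-form is a map $\omega:T^kM\to\mathbb{R}$ that is $k$-linear on $(T_mM)^k$ for each $m$; it is smooth if $\omega\in\tau^k\mathcal{C}$. For smooth $F:M\to N$, $(TFv)(f)=v(f\circ F)$ and $(F^*\omega)(v_1,\ldots,v_k)=\omega(TFv_1,\ldots,TFv_k)$. A function $\beta$ multiplies a form through its value at the base point; $(\omega_1\wedge\cdots\wedge\omega_k)(v_1,\ldots,v_k)=\det(\omega_i(v_j))$ for 1-forms. $\mathcal{U}_{\mathcal{G}}$ is the weakest uniform structure on $M$ making all $g\in\mathcal{G}$ uniformly continuous; ''uniform'' means uniformly continuous. $\mathcal{T}\mathcal{G}_0=\{g\circ\pi,\ dg:g\in\mathcal{G}\}$, and the uniform structure it gives on $TM$ is the weakest one making all its members uniformly continuous. A generalized $n$-dimensional smooth cube on $(M,\mathcal{C})$ is a smooth map $\varphi:(D,C^\infty(\mathbb{R}^n)_D)\to(M,\mathcal{C})$ with $D$ dense in $[0,1]^n$. Each $T_tD$ has basis $\frac{\partial}{\partial t^1}|_t,\ldots,\frac{\partial}{\partial t^n}|_t$, so $TD$ is identified with $D\times\mathbb{R}^n$ and given its standard uniform structure (inherited from $[0,1]^n\times\mathbb{R}^n$). A $k$-form on $D$ or $[0,1]^n$ is $\sum_{i_1<\cdots<i_k}f_{i_1\ldots i_k}dt^{i_1}\wedge\cdots\wedge dt^{i_k}$; it is continuous if its coefficients are. A smooth partition of unity subordinated to $\{U_i\}$ is a family $\gamma_i\in\mathcal{C}$,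 $\gamma_i\ge0$, with $supp\,\gamma_i\subset U_i$ (closed support) and $\sum_i\gamma_i=1$. *)

(* Defs.v *)
From HB Require Import structures.
From mathcomp Require Import all_boot all_order all_algebra fingroup perm.
From mathcomp Require Import all_classical all_reals all_analysis.
From mathcomp Require Import ring.

Set Implicit Arguments.
Unset Strict Implicit.
Unset Printing Implicit Defensive.

Import Order.TTheory GRing.Theory Num.Theory.
Import numFieldNormedType.Exports.

Local Open Scope classical_set_scope.
Local Open Scope ring_scope.

Section smooth_functions.
Variables (R : realType) (n : nat).
Implicit Types f : 'rV[R]_n -> R.

Fixpoint Ck (k : nat) f : Prop :=
  if k is k'.+1 then
    continuous f /\
    forall i : 'I_n, (forall x, derivable f x (delta_mx 0 i)) /\
                     Ck k' ('D_(delta_mx 0 i) f)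
  else continuous f.

Definition Cinf : set ('rV[R]_n -> R) := [set f | forall k, Ck k f].

Lemma Ck_cst k (c : R) : Ck k (cst c).
Proof.
elim: k c => [|k IH] c /=; first by exact: cst_continuous.
split; first by exact: cst_continuous.
move=> i; split=> [x|]; first exact: derivable_cst.
suff -> : 'D_(delta_mx 0 i) (cst c : 'rV[R]_n -> R) = cst 0 by exact: IH.
by apply/funext => x; rewrite derive_cst.
Qed.

Lemma is_derive_coord (i : 'I_n) (x v : 'rV[R]_n) :
  is_derive x v (fun t : 'rV[R]_n => t 0 i) (v 0 i).
Proof.
have E : (fun h : R => h^-1 *: (((h *: v + x : 'rV[R]_n) 0 i) - x 0 i))
    @ 0^' --> (v 0 i).
  apply/cvgrPdist_lt => e e0; near=> h.
  rewrite !mxE addrK [_ *: _]mulrA mulVf ?mul1r ?subrr ?normr0 //.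
  near: h; exact: nbhs_dnbhs_neq.
apply: DeriveDef; first by apply/cvg_ex; exists (v 0 i).
exact: cvg_lim E.
Unshelve. all: end_near. Qed.

Lemma Cinf_coord (i : 'I_n) : Cinf (fun t => t 0 i).
Proof.
case=> [|k] /=; first exact: coord_continuous.
split; first exact: coord_continuous.
move=> j; split=> [x|]; first by case: (is_derive_coord i x (delta_mx 0 j)).
suff -> : 'D_(delta_mx 0 j) (fun t : 'rV[R]_n => t 0 i) =
          cst ((delta_mx 0 j : 'rV[R]_n) 0 i) by exact: Ck_cst.
by apply/funext => x; case: (is_derive_coord i x (delta_mx 0 j)).
Qed.

End smooth_functions.
Arguments Cinf {R} n.

Section differential_structures.
Variable R : realType.
Implicit Types M N : choiceType.

Definition weak_top M (C : set (M -> R)) : topologicalType :=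
  sup_topology (fun f : C => Topological.on (initial_topology (val f))).

Definition weak_unif M (G : set (M -> R)) : uniformType :=
  sup_topology (fun g : G => Uniform.class (initial_topology (val g))).

Definition uniform_wrt M (G : set (M -> R)) (f : M -> R) : Prop :=
  unif_continuous (f : weak_unif G -> R).

Record differential_structure M (C : set (M -> R)) : Prop := {
  ds_comp : forall (r : nat) (f : 'I_r -> M -> R) (sigma : 'rV[R]_r -> R),
    (forall i, C (f i)) -> Cinf r sigma ->
    C (fun x => sigma (\row_i f i x));
  ds_local : forall f : M -> R,
    (forall x, exists2 g, C g & \forall y \near (x : weak_top C), f y = g y) ->
    C f }.

Definition generated M (G : set (M -> R)) : set (M -> R) :=
  smallest (@differential_structure M) G.

Definition induced M N (F : M -> N) (D : set (N -> R)) : set (M -> R) :=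
  generated [set f \o F | f in D].

Definition smooth_map M N (C : set (M -> R)) (D : set (N -> R))
  (F : M -> N) : Prop := forall f, D f -> C (f \o F).

Record smooth_partition_of_unity M (C : set (M -> R)) (q : nat)
    (U : 'I_q -> set M) (gamma : 'I_q -> M -> R) : Prop := {
  pou_smooth : forall i, C (gamma i);
  pou_ge0 : forall i x, 0 <= gamma i x;
  pou_supp : forall i,
    closure ([set x | gamma i x != 0] : set (weak_top C)) `<=` U i;
  pou_sum : forall x, \sum_(i < q) gamma i x = 1 }.

Lemma weak_top_cvg M (C : set (M -> R)) (F : set_system M) (x : M) :
  Filter F ->
  F --> (x : weak_top C) <-> (forall f, C f -> f @ F --> f x).
Proof.
move=> FF; rewrite cvg_sup; split=> [H f Cf|H f].
  apply: cvg_trans (@initial_continuous M R f x).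
  exact: (cvg_app f (H (exist _ f (mem_set Cf)))).
move=> A /= [_ [[B oB <-] Bx BA]].
have Cf : C (val f) := set_mem (valP f).
suff : F (val f @^-1` B) by apply: filterS.
by apply: (H _ Cf); exact: open_nbhs_nbhs.
Qed.

Lemma weak_top_continuous M (C : set (M -> R)) f :
  C f -> continuous (f : weak_top C -> R).
Proof.
move=> Cf x.
by apply: (weak_top_cvg C x (nbhs_filter (x : weak_top C))).1 Cf; exact: cvg_id.
Qed.

Lemma weak_top_le M (C C' : set (M -> R)) (x : M) : C `<=` C' ->
  nbhs (x : weak_top C') --> (x : weak_top C).
Proof.
move=> CC'; apply/weak_top_cvg => f Cf.
exact: (weak_top_continuous (CC' _ Cf)).
Qed.

Lemma generated_struct M (G : set (M -> R)) :
  differential_structure (generated G).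
Proof.
split=> [r f sigma Gf ssm C [dC GC]|f Hf C [dC GC]].
  by apply: (ds_comp dC) => // i; exact: (Gf i C).
apply: (ds_local dC) => // x; have [g Gg fg] := Hf x.
exists g; first exact: (Gg C).
apply: (weak_top_le (C := generated G)) fg.
exact: (smallest_sub dC GC).
Qed.

Lemma smooth_map_generated M N (C : set (M -> R)) (G : set (N -> R)) F :
  differential_structure C -> (forall g, G g -> C (g \o F)) ->
  smooth_map C (generated G) F.
Proof.
move=> dC GC f /(_ (fun f => C (f \o F))); apply.
split=> //; split=> [r g s Cg ss|g Hg].
  exact: (ds_comp dC Cg ss).
apply: (ds_local dC) => x; have [h Ch gh] := Hg (F x).
exists (h \o F) => //.
have : F @ (x : weak_top C) -->
    (F x : weak_top (fun f => C (f \o F))).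
  have FF := fmap_filter F (nbhs_filter (x : weak_top C)).
  apply/weak_top_cvg => u Cu.
  exact: (weak_top_continuous Cu).
by move=> /(_ _ gh).
Qed.

End differential_structures.

Section tangent.
Variables (R : realType) (M : choiceType) (C : set (M -> R)).

(* [C] is closed under linear combinations and products, so the functions [h]
   below always exist; this phrasing avoids equipping [C] with an algebra
   structure. *)
Definition derivation_at (m : M) : set (C -> R^o) :=
  [set v | (forall (a : R) (f g h : C),
              val h = (fun x => a * val f x + val g x) ->
              v h = a * v f + v g)
         /\ (forall f g h : C,
              val h = (fun x => val f x * val g x) ->
              v h = val f m * v g + val g m * v f)].

Definition derivation_pred m : {pred C -> R^o} :=
  fun v => `[< derivation_at m v >].

Lemma derivation_submod m : submod_closed (derivation_pred m).
Proof.
split=> [|a u v].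
  by apply/asboolP; split=> *; rewrite !mulr0 addr0.
move=> /asboolP[ul um] /asboolP[vl vm]; apply/asboolP; split=> [b f g h hE|f g h hE].
  by rewrite !fctE /= (ul _ _ _ _ hE) (vl _ _ _ _ hE) /GRing.scale /=; ring.
by rewrite !fctE /= (um _ _ _ hE) (vm _ _ _ hE) /GRing.scale /=; ring.
Qed.

HB.instance Definition _ m :=
  GRing.isSubmodClosed.Build R (C -> R^o) (derivation_pred m)
    (derivation_submod m).

Record tangent (m : M) := Tangent {
  tangent_fun :> C -> R^o;
  tangentP : tangent_fun \in derivation_pred m }.

HB.instance Definition _ m := [isSub for @tangent_fun m].
HB.instance Definition _ m := [Choice of tangent m by <:].
HB.instance Definition _ m := [SubChoice_isSubLmodule of tangent m by <:].

Definition TM : Type := {m : M & tangent m}.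
HB.instance Definition _ := gen_eqMixin TM.
HB.instance Definition _ := gen_choiceMixin TM.

Definition TMproj (v : TM) : M := projT1 v.

Definition dfun (f : C) (v : TM) : R := projT2 v f.

Definition TC : set (TM -> R) :=
  generated [set h | exists f : C, h = val f \o TMproj \/ h = dfun f].

Definition TG0 (G : set (M -> R)) : set (TM -> R) :=
  [set h | exists2 g : C, G (val g) & h = val g \o TMproj \/ h = dfun g].

Variable k : nat.

(* The k-tuples of tangent vectors with a common base point, presented as a
   base point together with k vectors of its tangent space; [Tk_incl] is the
   inclusion into (TM)^k. *)
Definition Tk : Type := {m : M & 'I_k -> tangent m}.
HB.instance Definition _ := gen_eqMixin Tk.
HB.instance Definition _ := gen_choiceMixin Tk.

Definition Tk_base (w : Tk) : M := projT1 w.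

Definition Tk_incl (w : Tk) : 'I_k -> TM :=
  fun i => existT _ (projT1 w) (projT2 w i).

Definition TMpow : set (('I_k -> TM) -> R) :=
  generated [set h | exists i, exists2 f, TC f & h = fun v => f (v i)].

Definition tauC : set (Tk -> R) := induced Tk_incl TMpow.

Definition point_form (omega : Tk -> R) : Prop :=
  forall (m : M) (v : 'I_k -> tangent m) (i : 'I_k) (a : R) (x y : tangent m),
    omega (existT _ m (dfwith v i (a *: x + y))) =
    a * omega (existT _ m (dfwith v i x)) + omega (existT _ m (dfwith v i y)).

Definition smooth_form (omega : Tk -> R) : Prop :=
  point_form omega /\ tauC omega.

Definition skew_symmetric (omega : Tk -> R) : Prop :=
  forall (m : M) (v : 'I_k -> tangent m) (s : 'S_k),
    omega (existT _ m (v \o s)) = (-1) ^+ s * omega (existT _ m v).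

Definition wedge (omega : 'I_k -> TM -> R) (w : Tk) : R :=
  \det (\matrix_(i, j) omega i (Tk_incl w j)).

End tangent.
Arguments TG0 {R M} C G.

Section tangent_map.
Variables (R : realType) (M N : choiceType).
Variables (C : set (M -> R)) (D : set (N -> R)) (F : M -> N).
Hypothesis hF : smooth_map C D F.

Definition pull_fun (f : D) : C :=
  exist _ (val f \o F) (mem_set (hF (set_mem (valP f)))).

Lemma tangent_mapP m (v : tangent C m) :
  (fun f => v (pull_fun f)) \in derivation_pred (C := D) (F m).
Proof.
have /asboolP[vl vm] := tangentP v; apply/asboolP.
split=> [a f g h hE|f g h hE].
  by apply: vl => /=; rewrite hE.
by apply: (vm (pull_fun f) (pull_fun g)) => /=; rewrite hE.
Qed.

Definition tangent_map m (v : tangent C m) : tangent D (F m) :=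
  Tangent (tangent_mapP v).

Definition Tmap (v : TM C) : TM D :=
  existT _ (F (projT1 v)) (tangent_map (projT2 v)).

Definition pullback k (omega : Tk D k -> R) (w : Tk C k) : R :=
  omega (existT _ (F (projT1 w)) (fun i => tangent_map (projT2 w i))).

End tangent_map.

Section euclidean_subsets.
Variables (R : realType) (n : nat).
Implicit Types A B : set 'rV[R]_n.

Definition Cinf_on A : set (A -> R) :=
  induced (val : A -> 'rV[R]_n) (Cinf n).
Arguments Cinf_on : clear implicits.

Lemma coord_subproof A (i : 'I_n) : Cinf_on A (fun t : A => val t 0 i).
Proof.
apply: sub_gen_smallest; exists (fun t : 'rV[R]_n => t 0 i) => //.
exact: Cinf_coord.
Qed.

Definition coord A (i : 'I_n) : Cinf_on A :=
  exist _ (fun t : A => val t 0 i) (mem_set (@coord_subproof A i)).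

(* TA identified with A x R^n: as d/dt^i (t^j) = delta_ij, the coordinates of
   a vector v in the basis (d/dt^i) are the v(t^i). *)
Definition TA_coord A (v : TM (Cinf_on A)) : A * 'rV[R]_n :=
  (TMproj v, \row_i dfun (coord A i) v).

Definition TA_unif A : uniformType := initial_topology (@TA_coord A).

Definition increasing k (I : {ffun 'I_k -> 'I_n}) : bool :=
  [forall a : 'I_k, forall b : 'I_k, (a < b)%N ==> (I a < I b)%N].

Definition coord_form A k (f : {ffun 'I_k -> 'I_n} -> A -> R)
    (w : Tk (Cinf_on A) k) : R :=
  \sum_(I : {ffun 'I_k -> 'I_n} | increasing I)
    f I (Tk_base w) * wedge (fun a => dfun (coord A (I a))) w.

Definition continuous_form A k (omega : Tk (Cinf_on A) k -> R) : Prop :=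
  exists2 f, (forall I, increasing I -> continuous (f I : A -> R)) &
             omega = coord_form f.

Definition set_incl A B (AB : A `<=` B) (t : A) : B :=
  exist _ (val t) (mem_set (AB _ (set_mem (valP t)))).

Lemma smooth_set_incl A B (AB : A `<=` B) :
  smooth_map (Cinf_on A) (Cinf_on B) (set_incl AB).
Proof.
apply: smooth_map_generated; first exact: generated_struct.
move=> _ [f Cf <-]; apply: sub_gen_smallest; exists f => //.
Qed.

Definition unit_cube : set 'rV[R]_n := [set t | forall i, 0 <= t 0 i <= 1].

Definition dense_in A B : Prop := A `<=` B /\ B `<=` closure A.

End euclidean_subsets.
Arguments Cinf_on {R n} A _.
Arguments unit_cube {R n}.

(* Main.v *)
(** The form [phi^* eta] is a finite sum of terms
      [(gamma_i o phi) (beta_ij o phi) d(alpha_ij^1 o phi) /\ ...],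
    and by the Cauchy-Binet formula its coefficients in the [dt^I] are
    polynomials in the functions [gamma_i o phi], [beta_ij o phi] and
    [d/dt^l (alpha_ij^a o phi)].  All of these are uniformly continuous on [D]:
    compose [T phi] with the sections [t |-> (t, 0)] and [t |-> (t, d/dt^l)] of
    [TD].  Hence they extend continuously to the closure [[0,1]^n] of [D].

    The vectors [d/dt^l] exist because every element of [C^oo(R^n)_D] has near
    each [t] a representative differentiable at [t], whose partial derivatives
    at [t] are determined by its values on the dense set [D].  That they span
    the tangent spaces would need Hadamard's lemma; here it is enough that they
    do so as far as the functions [g o phi], [g] in [G], can see.  This already
    follows from the uniform continuity of [T phi], since every entourage of
    [TD] contains all pairs of vectors with the same coordinates. *)
From HB Require Import structures.
From mathcomp Require Import all_boot all_order all_algebra fingroup perm.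
From mathcomp Require Import all_classical all_reals all_analysis.
From mathcomp Require Import finmap lra.
Require Import Defs.

Set Implicit Arguments.
Unset Strict Implicit.
Unset Printing Implicit Defensive.

Import Order.TTheory GRing.Theory Num.Theory.
Import numFieldNormedType.Exports.

Local Open Scope classical_set_scope.
Local Open Scope ring_scope.

(** * The Cauchy-Binet formula over increasing index maps *)

Section cauchy_binet.
Variables (k n : nat).
Implicit Types (f I : {ffun 'I_k -> 'I_n}) (s : 'S_k).

Local Notation act f s := [ffun a => fun_of_fin f (fun_of_perm s a)].

Let actK s : cancel (fun f => act f s) (fun f => act f s^-1%g).
Proof. by move=> f; apply/ffunP => a; rewrite !ffunE permKV. Qed.

Let actVK s : cancel (fun f => act f s^-1%g) (fun f => act f s).
Proof. by move=> f; apply/ffunP => a; rewrite !ffunE permK. Qed.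

(** Passing to the list of values lets uniqueness of sorted lists be applied to increasing index
    maps. *)
Lemma increasing_sorted f :
  increasing f = sorted ltn [seq val x | x <- codom f].
Proof.
have szE : size [seq val x | x <- codom f] = k.
  by rewrite size_map size_codom card_ord.
have nthE (a : 'I_k) : nth 0%N [seq val x | x <- codom f] a = f a.
  rewrite (nth_map (f a)) ?size_codom ?card_ord // codomE.
  by rewrite (nth_map a) ?size_enum_ord // nth_ord_enum.
apply/idP/idP => [inc|].
  apply/(sortedP 0%N) => i; rewrite szE => ik.
  have ik' : (i < k)%N by exact: ltnW.
  have := nthE (Ordinal ik); have := nthE (Ordinal ik') => /= -> ->.
  by move/forallP/(_ (Ordinal ik'))/forallP/(_ (Ordinal ik))/implyP: inc; apply.
rewrite (sorted_pairwise ltn_trans) => /(pairwiseP 0%N) H.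
apply/forallP => a; apply/forallP => b; apply/implyP => ab.
by rewrite -!nthE; apply: H; rewrite ?inE ?szE.
Qed.

Lemma increasing_inj f : increasing f -> injective f.
Proof.
move=> inc a b fab; apply/eqP; apply: contraTT isT => neq.
wlog ab : a b fab neq / (a < b)%N => [W|].
  by case: (ltngtP a b) => [ab|ab|/val_inj/eqP]; [exact: W ab|
    apply: (W b a) => //; rewrite eq_sym|rewrite (negbTE neq)].
by move/forallP/(_ a)/forallP/(_ b)/implyP/(_ ab): inc; rewrite fab ltnn.
Qed.

(** Both rearrangements list the values of [f] in strictly increasing order, so they are the same
    list; injectivity of [f] then recovers the permutation. *)
Lemma increasing_sort_unique f s s' : injective f ->
  increasing (act f s) -> increasing (act f s') -> s = s'.
Proof.
move=> finj; rewrite !increasing_sorted => inc inc'.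
have E : [seq val x | x <- codom (act f s)] =
         [seq val x | x <- codom (act f s')].
  apply: (irr_sorted_eq ltn_trans ltnn inc inc') => x.
  have im u : (x \in [seq val y | y <- codom (act f u)]) =
                (x \in [seq val y | y <- codom f]).
    apply/mapP/mapP => -[_ /codomP[a ->] ->].
      by rewrite ffunE; exists (f (u a)) => //; exact: codom_f.
    by exists (act f u (u^-1 a)%g); rewrite ?codom_f // ffunE permKV.
  by rewrite !im.
have /eq_in_map E' := inj_map val_inj E.
by apply/permP => a; apply: finj; have := E' a; rewrite mem_enum !ffunE; apply.
Qed.

(** Sorting the tuple of values provides [s]. The sorted list is only weakly increasing; injectivity
    of [f] makes it strict. *)
Lemma increasing_sort_exists f : injective f -> exists s, increasing (act f s).
Proof.
move=> finj.
pose t := [tuple f i | i < k].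
pose t' := sort_tuple (fun x y : 'I_n => (x <= y)%N) t.
have /tuple_permP[s tE] : perm_eq t' t by rewrite perm_sort.
exists s; apply/forallP => a; apply/forallP => b; apply/implyP => ab.
have nthE (c : 'I_k) : nth (f a) t' c = act f s c.
  by rewrite tE -(tnth_nth (f a) (mktuple _)) tnth_mktuple tnth_mktuple ffunE.
have st : sorted (fun x y : 'I_n => (x <= y)%N) t'.
  by apply: sort_sorted => x y; exact: leq_total.
rewrite ltn_neqAle; apply/andP; split.
  apply: contraTN ab => /eqP /val_inj; rewrite !ffunE => /finj/perm_inj ->.
  by rewrite ltnn.
rewrite -!nthE.
apply: (sorted_ltn_nth _ (f a) st) => //; rewrite ?inE ?size_tuple //.
by move=> x y z; exact: leq_trans.
Qed.

(** Every injective index map factors uniquely as an increasing map after a permutation. *)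
Lemma sum_injective_sort (V : nmodType) (F : {ffun 'I_k -> 'I_n} -> V) :
  \sum_(f : {ffun 'I_k -> 'I_n} | injectiveb f) F f =
  \sum_(I | increasing I) \sum_(s : 'S_k) F [ffun a => I (s a)].
Proof.
rewrite exchange_big /=.
transitivity (\sum_(f : {ffun 'I_k -> 'I_n} | injectiveb f)
                \sum_(s | increasing (act f s)) F f).
  apply: eq_bigr => f /injectiveP finj.
  have [s0 s0P] := increasing_sort_exists finj.
  rewrite (big_pred1 s0) // => s /=; apply/idP/eqP => [|-> //].
  by move/(increasing_sort_unique finj)/(_ s0P).
(* With [s] replaced by its inverse, the substitution of [I] after [s] for [f] turns the condition
   on [f] into monotonicity of [I]. *)
rewrite (exchange_big_dep xpredT) //= (reindex_inj invg_inj) /=.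
apply: eq_bigr => s _.
rewrite (reindex (fun f => act f s));
  last by exists (fun f => act f s^-1%g) => ? _; rewrite ?actK ?actVK.
apply: eq_bigl => I; rewrite actK andbC.
case: (boolP (increasing I)) => //= /increasing_inj Iinj.
by apply/injectiveP => a b; rewrite !ffunE => /Iinj/perm_inj.
Qed.

(** Distributing the products of entries gives a sum over all index maps. A non-injective one
    repeats a row of [B] and contributes 0. The others are grouped by their increasing
    rearrangement: permuting the rows of [B] produces exactly the signs that reassemble the minor of
    [A]. *)
Lemma cauchy_binet (K : comPzRingType) (A : 'M[K]_(k, n)) (B : 'M[K]_(n, k)) :
  \det (A *m B) =
  \sum_(I : {ffun 'I_k -> 'I_n} | increasing I)
    \det (\matrix_(i, j) A i (I j)) * \det (\matrix_(i, j) B (I i) j).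
Proof.
transitivity (\sum_(f : {ffun 'I_k -> 'I_n}) (\prod_i A i (f i)) *
                \det (\matrix_(i, j) B (f i) j)).
  rewrite {1}/determinant.
  under eq_bigr => s _.
    under eq_bigr => i _ do rewrite mxE.
    rewrite bigA_distr_bigA big_distrr /=.
    over.
  rewrite exchange_big; apply: eq_bigr => f _ /=.
  rewrite big_distrr /=; apply: eq_bigr => s _.
  by rewrite big_split /= mulrCA; do 2!congr (_ * _);
    apply: eq_bigr => i _; rewrite mxE.
rewrite (bigID (fun f : {ffun 'I_k -> 'I_n} => injectiveb f)) /=.
rewrite [X in _ + X]big1 ?addr0; last first.
  move=> f /injectivePn[a [b ab fab]].
  by rewrite (determinant_alternate ab) ?mulr0 // => j; rewrite !mxE fab.
rewrite sum_injective_sort; apply: eq_bigr => I _.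
transitivity (\sum_(s : 'S_k) ((-1) ^+ s * \prod_i A i (I (s i))) *
                \det (\matrix_(i, j) B (I i) j)); last first.
  rewrite -big_distrl /=; congr (_ * _); apply: eq_bigr => s _.
  by congr (_ * _); apply: eq_bigr => i _; rewrite mxE.
apply: eq_bigr => s _.
have -> : (\matrix_(i, j) B ([ffun a => I (s a)] i) j) =
          row_perm s (\matrix_(i, j) B (I i) j).
  by apply/matrixP => i j; rewrite !mxE ffunE.
rewrite row_permE det_mulmx det_perm mulrCA mulrA; congr (_ * _ * _).
by apply: eq_bigr => i _; rewrite ffunE.
Qed.

End cauchy_binet.

(** * Continuity of finite sums, products and determinants *)

Section continuous_bigops.
Variables (R : realType) (T : topologicalType) (I : Type) (r : seq I).
Variables (P : pred I) (F : I -> T -> R).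
Hypothesis F_cont : forall i, P i -> continuous (F i).

Lemma continuous_sumr : continuous (fun x => \sum_(i <- r | P i) F i x).
Proof.
apply: continuous_big => //; exact: add_continuous.
Qed.

Lemma continuous_prodr : continuous (fun x => \prod_(i <- r | P i) F i x).
Proof.
apply: continuous_big => //; exact: mul_continuous.
Qed.

End continuous_bigops.

Lemma continuous_det (R : realType) (T : topologicalType) (k : nat)
    (F : 'I_k -> 'I_k -> T -> R) : (forall i j, continuous (F i j)) ->
  continuous (fun x => \det (\matrix_(i, j) F i j x)).
Proof.
move=> F_cont; apply: continuous_sumr => s _ x.
apply: cvgM; first exact: cvg_cst.
under eq_fun do under eq_bigr do rewrite mxE.
under eq_bigr do rewrite mxE.
by apply: continuous_prodr => i _; exact: F_cont.
Qed.

(** * Coordinate bounds for the norm, and differentiability of C^1 functions *)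

Section row_norm.
Variables (R : realType) (n : nat).
Implicit Types h : 'rV[R]_n.

Lemma ler_coord_norm h i : `|h 0 i| <= `|h|.
Proof.
rewrite [leRHS]mx_normrE.
exact: (le_bigmax _ (fun ij : 'I_1 * 'I_n => `|h ij.1 ij.2|) (0, i)).
Qed.

Lemma rV_norm_ler h e : 0 <= e -> (forall i, `|h 0 i| <= e) -> `|h| <= e.
Proof.
move=> e0 he; rewrite [leLHS]mx_normrE; apply: bigmax_le => // -[i j] _ /=.
by rewrite (ord1 i).
Qed.

End row_norm.

Section C1_differentiable.
Variables (R : realType) (n : nat) (f : 'rV[R]_n -> R).
Hypothesis f_der : forall i x, derivable f x (delta_mx 0 i).
Hypothesis f_C1 : forall i, continuous ('D_(delta_mx 0 i) f).

Lemma is_derive_line (i : 'I_n) (y : 'rV[R]_n) (s : R) :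
  is_derive s 1 (fun s => f (s *: delta_mx 0 i + y))
    ('D_(delta_mx 0 i) f (s *: delta_mx 0 i + y)).
Proof.
set e := delta_mx 0 i.
have E : (fun h => h^-1 *: (f ((h *: 1 + s) *: e + y) - f (s *: e + y))) =
         (fun h => h^-1 *: (f (h *: e + (s *: e + y)) - f (s *: e + y))).
  by apply/funext => h; rewrite scalerDl addrA [h *: 1]mulr1.
have := @f_der i (s *: e + y).
by move=> fd; apply: DeriveDef; rewrite /derivable /derive /= E.
Qed.

(** The one-variable mean value theorem between 0 and [a]; bounding [c] by absolute values covers
    both signs of [a]. *)
Lemma MVT_line (i : 'I_n) (y : 'rV[R]_n) (a : R) :
  exists2 c, `|c| <= `|a| & f (a *: delta_mx 0 i + y) - f y =
    'D_(delta_mx 0 i) f (c *: delta_mx 0 i + y) * a.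
Proof.
pose g s := f (s *: delta_mx 0 i + y).
have gd (s : R) : is_derive s 1 g ('D_(delta_mx 0 i) f (s *: delta_mx 0 i + y)).
  exact: is_derive_line.
have gc (A : set R) : {within A, continuous g}.
  apply: continuous_subspaceT => s; apply: differentiable_continuous.
  by apply/derivable1_diffP; case: (gd s).
have g0 : g 0 = f y by rewrite /g scale0r add0r.
have [a0|/ltW a0] := leP 0 a.
  have [c] := MVT_segment a0 (fun s _ => gd s) (@gc _).
  rewrite in_itv /= g0 subr0 => /andP[c0 ca] E; exists c => //.
  by rewrite !ger0_norm.
have [c] := MVT_segment a0 (fun s _ => gd s) (@gc _).
rewrite in_itv /= g0 sub0r => /andP[ac c0] E; exists c.
  by rewrite !ler0_norm // lerN2.
by rewrite -[LHS]opprB E mulrN opprK.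
Qed.

(** For [m] from 0 to [n] these points lead from 0 to [h], changing one coordinate at a time. *)
Let trunc (h : 'rV[R]_n) (m : nat) : 'rV[R]_n :=
  \row_j (if (j < m)%N then h 0 j else 0).

Let truncS h (i : 'I_n) : trunc h i.+1 = h 0 i *: delta_mx 0 i + trunc h i.
Proof.
apply/rowP => j; rewrite !mxE eqxx /= ltnS leq_eqVlt -(inj_eq val_inj).
by case: ltngtP; rewrite ?mulr0 ?add0r ?mulr1 ?addr0 // => /val_inj ->.
Qed.

(** The increment of [f] telescopes along the path [trunc h]. The mean value theorem turns each step
    into a partial derivative at an intermediate point, which continuity compares with the one at
    [x]. *)
Lemma C1_differentiable x : differentiable f x.
Proof.
pose L (h : 'rV[R]_n) : R := \sum_i h 0 i * 'D_(delta_mx 0 i) f x.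
have Llin : linear L.
  move=> a u v; rewrite /L scaler_sumr -big_split /=; apply: eq_bigr => i _.
  by rewrite !mxE mulrDl -mulrA.
pose LL : {linear 'rV[R]_n -> R} :=
  HB.pack L (GRing.isLinear.Build _ _ _ _ _ Llin).
have Lcont : continuous LL.
  apply: continuous_sumr => i _ y.
  apply: (@cvgM _ _ (nbhs y) _ (fun h : 'rV[R]_n => h 0 i)
            (cst ('D_(delta_mx 0 i) f x))); first exact: coord_continuous.
  exact: cvg_cst.
have LO : f \o shift x = cst (f x) + LL +o_ 0 id.
  apply/eqaddoP => e e0.
  (* The [n] errors add up to at most [e] times the norm of [h]; dividing by [n.+1] also covers
     [n = 0]. *)
  have e'0 : 0 < e / n.+1%:R by rewrite divr_gt0.
  have /nbhs_ballP[d /= d0 dP] : \forall z \near x, forall i : 'I_n,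
     `|'D_(delta_mx 0 i) f x - 'D_(delta_mx 0 i) f z| < e / n.+1%:R.
    apply: (@filter_forall _ 'I_n (fun i z =>
      `|'D_(delta_mx 0 i) f x - 'D_(delta_mx 0 i) f z| < e / n.+1%:R)
      _ (nbhs_filter x)) => i.
    by have /cvgrPdist_lt/(_ _ e'0) := @f_C1 i x.
  apply/nbhs_ballP; exists d => //= h; rewrite -ball_normE /= sub0r normrN => hd.
  have -> : (f \o shift x - (cst (f x) + LL)) h =
    \sum_(i < n) ((f (trunc h i.+1 + x) - f (trunc h i + x)) -
       h 0 i * 'D_(delta_mx 0 i) f x).
    rewrite sumrB -(big_mkord xpredT
      (fun i => f (trunc h i.+1 + x) - f (trunc h i + x))).
    rewrite telescope_sumr // !fctE opprD addrA; congr (_ - _); congr (f _ - f _).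
      by congr (_ + _); apply/rowP => j; rewrite mxE ltn_ord.
    by rewrite -[LHS]add0r; congr (_ + _); apply/rowP => j; rewrite !mxE.
  apply: le_trans (ler_norm_sum _ _ _) _.
  apply: (@le_trans _ _ (\sum_(i < n) `|h| * (e / n.+1%:R))).
    apply: ler_sum => i _; rewrite truncS -[_ *: _ + _ + _]addrA.
    have [c ch ->] := MVT_line i (trunc h i + x) (h 0 i).
    rewrite mulrC -mulrBr normrM.
    apply: ler_pM => //; first exact: ler_coord_norm.
    apply/ltW; rewrite distrC; apply: dP; rewrite addrA -ball_normE /=.
    rewrite opprD addrCA subrr addr0 normrN; apply: le_lt_trans hd.
    (* Coordinate [i] of [trunc h i] is 0, so the intermediate displacement is bounded by [h] in
       every coordinate. *)
    apply: rV_norm_ler => // j; rewrite !mxE eqxx /=.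
    have [<-|/eqP ji] := eqVneq i j.
      by rewrite ltnn addr0 mulr1; apply: le_trans ch _; exact: ler_coord_norm.
    rewrite mulr0 add0r; case: ifP => _; first exact: ler_coord_norm.
    by rewrite normr0.
  rewrite sumr_const card_ord -[_ *+ n]mulr_natr -mulrA [leRHS]mulrC.
  apply: ler_wpM2l => //; rewrite mulrAC ler_pdivrMr // ler_wpM2l ?ler_nat //.
  exact: ltW.
have dE := diff_unique Lcont LO.
by apply/diff_locallyP; rewrite dE.
Qed.

End C1_differentiable.

Lemma Cinf_differentiable (R : realType) (n : nat) (f : 'rV[R]_n -> R) x :
  Cinf n f -> differentiable f x.
Proof.
move=> f_inf; apply: C1_differentiable => [i y|i].
  by have [_ /(_ i)[]] := f_inf 1%N.
by have [_ /(_ i)[]] := f_inf 1%N.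
Qed.

(** * Extension of uniformly continuous functions from a dense subset *)

Section uniform_extension.
Variables (R : realType) (n : nat) (A B : set 'rV[R]_n) (f : A -> R).
Hypothesis hAB : dense_in A B.
Hypothesis f_unif : unif_continuous f.

Lemma closure_ball_ex (x : 'rV[R]_n) (d : R) : closure A x -> 0 < d ->
  exists t : A, ball x d (val t).
Proof.
move=> Ax d0; have [z [Az xz]] := Ax _ (nbhsx_ballx x _ d0).
by exists (exist _ z (mem_set Az)).
Qed.

Lemma unif_continuous_ballP e : 0 < e -> exists2 d, 0 < d &
  forall s t : A, ball (val s) d (val t) -> `|f s - f t| < e.
Proof.
move=> e0; have /unif_continuousP/(_ _ e0)[d d0 dP] := f_unif.
by exists d => // s t st; have := dP (s, t) st; rewrite -ball_normE.
Qed.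

(** The traces on [A] of the balls around [x] form a filter whose image under [f] is Cauchy, and [R]
    is complete. *)
Lemma unif_limit_ex (x : 'rV[R]_n) : closure A x -> exists l : R,
  forall e, 0 < e -> exists2 d, 0 < d &
    forall t : A, ball x d (val t) -> `|l - f t| < e.
Proof.
move=> Ax.
pose F := filter_from [set d : R | 0 < d]
  (fun d => [set t : A | ball x d (val t)]).
have FF : ProperFilter F.
  apply: filter_from_proper; last by move=> d /= d0; exact: closure_ball_ex.
  apply: filter_from_filter; first by exists 1 => /=.
  move=> a b /= a0 b0; exists (Num.min a b); first by rewrite /= lt_min a0.
  by move=> t /= xt; split; apply: le_ball xt; rewrite ge_min lexx ?orbT.
have : cauchy (f @ F).
  apply: cauchy_exP => e e0.
  have [d d0 dP] := unif_continuous_ballP e0.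
  have [s xs] := closure_ball_ex Ax (divr_gt0 d0 (ltr0n R 2)).
  exists (f s); exists (d / 2); first by rewrite /= divr_gt0.
  move=> t /= xt; rewrite -ball_normE /=; apply: dP.
  by rewrite (splitr d); apply: ball_triangle xt; exact: ball_sym.
move=> /cauchy_cvg/cvg_ex[l /= fl]; exists l => e e0.
by have /cvgrPdist_lt/(_ _ e0)[d d0 dP] := fl; exists d.
Qed.

Lemma unif_continuous_extension :
  exists2 g : B -> R, continuous g & forall t, g (set_incl hAB.1 t) = f t.
Proof.
have Bcl (x : B) : closure A (val x) by apply: hAB.2; exact: set_mem (valP x).
pose g (x : B) := sval (cid (unif_limit_ex (Bcl x))).
have gP e : 0 < e -> exists2 d, 0 < d &
    forall (x : B) (t : A), ball (val x) d (val t) -> `|g x - f t| < e.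
  move=> e0; have e20 : 0 < e / 2 by rewrite divr_gt0.
  have [d d0 dP] := unif_continuous_ballP e20.
  have d20 : 0 < d / 2 by rewrite divr_gt0.
  (* An auxiliary point [s] of [A] is taken so near [x] that [f s] approximates [g x], and within
     [d / 2] of [x], so that [s] and [t] are within [d]. The resulting modulus is uniform in [x]. *)
  exists (d / 2) => // x t xt.
  have [d' d'0 d'P] := svalP (cid (unif_limit_ex (Bcl x))) _ e20.
  have m0 : 0 < Num.min (d / 2) d' by rewrite lt_min d20.
  have [s xs] := closure_ball_ex (Bcl x) m0.
  have {}d'P : `|g x - f s| < e / 2.
    by apply: d'P; apply: le_ball xs; rewrite ge_min lexx orbT.
  have {}dP : `|f s - f t| < e / 2.
    apply: dP; rewrite (splitr d); apply: ball_triangle xt; apply: ball_sym.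
    by apply: le_ball xs; rewrite ge_min lexx.
  rewrite -(subrKA (f s)) (splitr e).
  by apply: le_lt_trans (ler_normD _ _) _; exact: ltrD.
exists g => [x|t]; last first.
  apply/eqP; rewrite -subr_eq0 -normr_le0; apply/ler_addgt0Pr => e /gP[d d0 dP].
  by rewrite add0r; apply/ltW/dP; exact: ballxx.
apply: (cvgrPdist_lt (FF := nbhs_filter x) g (g x)).2 => e e0.
have e20 : 0 < e / 2 by rewrite divr_gt0.
have [d d0 dP] := gP _ e20; have d20 : 0 < d / 2 by rewrite divr_gt0.
apply/nbhs_ballP; exists (d / 2) => //= y xy.
have [t yt] := closure_ball_ex (Bcl y) d20.
rewrite -(subrKA (f t)) (splitr e); apply: le_lt_trans (ler_normD _ _) _.
apply: ltrD; first by apply: dP; rewrite (splitr d); exact: ball_triangle yt.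
rewrite distrC; apply: dP; apply: le_ball yt.
by rewrite ler_pdivrMr // ler_peMr ?ltW // ltr1n.
Qed.

End uniform_extension.

(** * Differentiable representatives of smooth functions on [D] *)

Section differentiable_germs.
Variables (R : realType) (n : nat) (D : set 'rV[R]_n).
Implicit Types (t s : D) (f : D -> R) (F : 'rV[R]_n -> R).

Definition diff_rep t f F :=
  differentiable F (val t) /\ \forall s \near t, f s = F (val s).

Lemma diff_rep_continuous t f F : diff_rep t f F -> f @ nbhs t --> f t.
Proof.
move=> [Fd fF].
have -> : f t = F (val t) by exact: (nbhs_singleton fF).
have FF := nbhs_filter t.
have Fc : (F \o val) @ nbhs t --> F (val t).
  apply: (@cvg_comp _ _ _ (val : D -> 'rV[R]_n) F _ (nbhs (val t))).
    exact: initial_continuous.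
  exact: (differentiable_continuous Fd).
apply: cvg_trans Fc; apply: near_eq_cvg.
by apply: filterS fF => s ->.
Qed.

Lemma differentiable_row r (F : 'I_r -> 'rV[R]_n -> R) x :
  (forall i, differentiable (F i) x) ->
  differentiable (fun y => \row_i F i y) x.
Proof.
move=> Fd.
have -> : (fun y => \row_i F i y) =
    \sum_(i < r) (fun y => F i y *: (delta_mx 0 i : 'rV[R]_r)).
  apply/funext => y; rewrite fct_sumE [LHS]row_sum_delta.
  by apply: eq_bigr => i _; rewrite mxE.
by apply: differentiable_sum => i; exact: differentiableZl.
Qed.

(** By minimality of the generated structure, this gives every element of [Cinf_on D] a
    representative at [t]. *)
Lemma diff_rep_struct t :
  differential_structure [set f | exists F, diff_rep t f F].
Proof.
split=> [r f sigma fF ssm|f fP].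
  pose F i := sval (cid (fF i)).
  have FP i : diff_rep t (f i) (F i) := svalP (cid (fF i)).
  exists (fun x => sigma (\row_i F i x)); split.
    apply: (differentiable_comp (g := sigma)).
      by apply: differentiable_row => i; have [] := FP i.
    exact: Cinf_differentiable.
  have : \forall s \near t, forall i, f i s = F i (val s).
    apply: (@filter_forall _ 'I_r (fun i s => f i s = F i (val s))
      _ (nbhs_filter t)) => i.
    by have [] := FP i.
  have := nbhs_filter t => FF.
  by apply: filterS => s fs; congr sigma; apply/rowP => i; rewrite !mxE.
have [g [F [Fd gF]] fg] := fP t.
exists F; split=> //.
have FF := nbhs_filter t.
(* All members of the structure are continuous at [t], so a weak neighbourhood of [t] is one in the
   topology of [D]. *)
have tt : nbhs t --> (t : weak_top [set f | exists F, diff_rep t f F]).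
  by apply/weak_top_cvg => h [H]; exact: diff_rep_continuous.
have {}fg : nbhs t (fun y => f y = g y) by exact: tt fg.
by apply: filterS2 fg gF => s -> ->.
Qed.

Lemma Cinf_on_diff_rep t f : Cinf_on D f -> exists F, diff_rep t f F.
Proof.
move=> /(_ _ (conj (diff_rep_struct t) _)); apply.
move=> _ [F Finf <-]; exists F; split; first exact: Cinf_differentiable.
by apply: (filterE (F := nbhs t)).
Qed.

End differentiable_germs.

(** * Partial derivatives as tangent vectors of [D] *)

Section partial_derivations.
Variables (R : realType) (n : nat) (D : set 'rV[R]_n).
Hypothesis hD : dense_in D unit_cube.
Implicit Types (t s : D) (l : 'I_n).

(** The sign [c] points towards the farther of the two faces orthogonal to [e_l], which is at
    distance at least 1/2. *)
Lemma unit_cube_direction (x : 'rV[R]_n) l : unit_cube x ->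
  exists2 c : R, `|c| = 1 &
    forall a, 0 <= a <= 2^-1 -> unit_cube (x + (a * c) *: delta_mx 0 l).
Proof.
move=> xQ.
have H (c : R) : (forall a, 0 <= a <= 2^-1 -> 0 <= x 0 l + a * c <= 1) ->
    forall a, 0 <= a <= 2^-1 -> unit_cube (x + (a * c) *: delta_mx 0 l).
  move=> xc a a0 i; rewrite !mxE eqxx /=.
  by have [->|_] := eqVneq i l; rewrite ?mulr1 ?mulr0 ?addr0;
    [exact: xc|exact: xQ].
have /andP[x0 x1] := xQ l.
have [x2|x2] := leP (x 0 l) 2^-1.
  by exists 1; [rewrite normr1|apply: H => a /andP[a0 a2]; lra].
by exists (-1); [rewrite normrN1|apply: H => a /andP[a0 a2]; lra].
Qed.

(* Only [D], not a neighbourhood of [t], is available: the direction [e_l] is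
   reached from inside the cube and approximated there by points of [D]. *)
Lemma diff_eq0_on_dense t (H : 'rV[R]_n -> R) l : differentiable H (val t) ->
  (\forall s \near t, H (val s) = 0) -> 'd H (val t) (delta_mx 0 l) = 0.
Proof.
move=> Hd /nbhs_ballP[r /= r0 rP].
have Ht : H (val t) = 0 by apply: rP; exact: ballxx.
have [K K0 KP] := linear_lipschitz (diff_continuous Hd).
have [c c1 cP] := unit_cube_direction l (hD.1 _ (set_mem (valP t))).
set L := 'd H (val t) in KP *.
apply/eqP; rewrite -normr_le0; apply/ler_addgt0Pr => e e0; rewrite add0r.
(* The final estimate is [(2 + K) * eps]: the 2 comes from the displacement [h], the Lipschitz
   constant [K] from the error [w]. *)
pose eps := Num.min 1 (e / (2 + K)).
have eps0 : 0 < eps by rewrite lt_min ltr01 divr_gt0 // addr_gt0.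
have eps1 : eps <= 1 by rewrite ge_min lexx.
have [_ /eqaddoP/(_ _ eps0)/nbhs_ballP[d /= d0 dP]] := (diff_locallyP _ _).1 Hd.
(* The bound 1/2 keeps the step inside the cube; the other bound keeps [s], at distance at most
   [2 * a] from [t], in both balls. *)
pose a := Num.min 2^-1 (Num.min d r / 4).
have m0 : 0 < Num.min d r by rewrite lt_min d0.
have a0 : 0 < a by rewrite lt_min invr_gt0 ltr0n divr_gt0.
have a2 : a <= 2^-1 by rewrite ge_min lexx.
have am : 2 * a < Num.min d r.
  have : a <= Num.min d r / 4 by rewrite ge_min lexx orbT.
  by move: (Num.min d r) m0 => m; lra.
have /closure_ball_ex/(_ (mulr_gt0 eps0 a0))[s xs] :
    closure D (val t + (a * c) *: delta_mx 0 l).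
  by apply/hD.2/cP; rewrite ltW.
pose h := val s - val t.
pose w := (a * c) *: delta_mx 0 l - h.
have wE : `|w| < eps * a.
  by move: xs; rewrite -ball_normE /= [val t + _]addrC -addrA -[_ - val s]opprB.
have hE : h = (a * c) *: delta_mx 0 l - w by rewrite /w opprB addrC subrK.
have e1 : `|(a * c) *: (delta_mx 0 l : 'rV[R]_n)| <= a.
  rewrite normrZ normrM c1 mulr1 (gtr0_norm a0) ler_piMr ?(ltW a0) //.
  apply: rV_norm_ler => // i; rewrite mxE eqxx /=.
  by case: (i == l); rewrite ?normr1 ?normr0.
have h2 : `|h| <= 2 * a.
  rewrite hE; apply: le_trans (ler_normB _ _) _.
  have : `|w| <= a by rewrite (le_trans (ltW wE)) // ler_piMl // ltW.
  lra.
have Lh : `|L h| <= eps * (2 * a).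
  have /dP : ball 0 d h.
    rewrite -ball_normE /= sub0r normrN (le_lt_trans h2) // (lt_le_trans am) //.
    by rewrite ge_min lexx.
  have Hs : H (val s) = 0.
    apply: rP; suff : ball (val t) r (val s) by [].
    rewrite -ball_normE /= distrC (le_lt_trans h2) // (lt_le_trans am) //.
    by rewrite ge_min lexx orbT.
  rewrite !fctE /= Ht add0r /h subrK Hs sub0r normrN => /le_trans; apply.
  by rewrite ler_wpM2l // ltW.
have Lw : `|L w| <= K * (eps * a).
  by apply: le_trans (KP w) _; rewrite ler_wpM2l ?ltW.
have : `|L ((a * c) *: delta_mx 0 l)| <= a * ((2 + K) * eps).
  have -> : (a * c) *: delta_mx 0 l = h + w :> 'rV[R]_n by rewrite /w addrC subrK.
  rewrite linearD; apply: le_trans (ler_normD _ _) _; lra.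
rewrite linearZ normrZ normrM c1 mulr1 (gtr0_norm a0) ler_pM2l // => /le_trans.
apply; rewrite mulrC -ler_pdivlMr; last by rewrite addr_gt0.
by rewrite ge_min lexx orbT.
Qed.

(** The difference [F - G] vanishes on [D] near [t]. This makes [partial_fun] independent of the
    chosen representative. *)
Lemma diff_rep_unique t f F G l : diff_rep t f F -> diff_rep t f G ->
  'd F (val t) (delta_mx 0 l) = 'd G (val t) (delta_mx 0 l).
Proof.
move=> [Fd fF] [Gd fG]; apply/eqP; rewrite -subr_eq0; apply/eqP.
have := @diff_eq0_on_dense t (F - G) l; rewrite diffB //; apply.
  exact: differentiableB.
have := nbhs_filter t => FF.
by apply: filterS2 fF fG => s; rewrite !fctE => -> ->; rewrite subrr.
Qed.

Definition partial_fun t l (f : Cinf_on D) : R :=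
  'd (sval (cid (Cinf_on_diff_rep t (set_mem (valP f))))) (val t) (delta_mx 0 l).

Lemma partial_funE t l (f : Cinf_on D) F : diff_rep t (val f) F ->
  partial_fun t l f = 'd F (val t) (delta_mx 0 l).
Proof. by move=> fF; apply: diff_rep_unique fF; exact: svalP (cid _). Qed.

Lemma partial_derivation t l : (partial_fun t l : _ -> R^o) \in derivation_pred t.
Proof.
apply/asboolP; split=> [a f g h hE|f g h hE];
    have [F fF] := Cinf_on_diff_rep t (set_mem (valP f));
    have [G gG] := Cinf_on_diff_rep t (set_mem (valP g));
    rewrite (partial_funE l fF) (partial_funE l gG);
    have [Fd fFE] := fF; have [Gd gGE] := gG; have := nbhs_filter t => FF.
  rewrite (@partial_funE _ _ _ (a \*: F + G)).
    by rewrite diffD // ?diffZ //; exact: differentiableZ.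
  split; first by apply: differentiableD => //; exact: differentiableZ.
  by apply: filterS2 fFE gGE => s fs gs; rewrite hE fs gs.
rewrite (@partial_funE _ _ _ (F * G)).
  by rewrite diffM // (nbhs_singleton fFE) (nbhs_singleton gGE).
split; first exact: differentiableM.
by apply: filterS2 fFE gGE => s fs gs; rewrite hE fs gs.
Qed.

Definition partial t l : tangent (Cinf_on D) t := Tangent (partial_derivation t l).

Lemma partial_coord t l i : partial t l (coord D i) = (i == l)%:R.
Proof.
rewrite /= (@partial_funE _ _ _ (fun x => x 0 i)).
  rewrite -deriveE; last exact: differentiable_coord.
  by have [_ ->] := is_derive_coord i (val t) (delta_mx 0 l); rewrite mxE eqxx.
split; first exact: differentiable_coord.
by apply: (filterE (F := nbhs t)).
Qed.

End partial_derivations.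

(** * Weak uniform structures and the uniform structure of [TD] *)

Section weak_uniformity.
Variables (R : realType) (M : choiceType) (G : set (M -> R)).

Lemma weak_unif_continuous g : G g -> unif_continuous (g : weak_unif G -> R).
Proof.
move=> Gg E entE.
pose P := (fun xy : M * M => (g xy.1, g xy.2)) @^-1` E.
pose i : {classic G} := exist _ g (mem_set Gg).
have Pent : `[< @entourage (initial_topology g) P >].
  by apply/asboolP; exists E.
exists P => //.
pose iP := exist (fun p : {classic G} * set (M * M) =>
   `[< @entourage (initial_topology (val p.1)) p.2 >]) (i, P) Pent.
(* Entourages of the supremum come from finite intersections; here one member suffices. *)
exists [fset iP]%fset; first by move=> ? _; exact: in_setT.
rewrite eqEsubset; split=> [xy capxy|xy Pxy p].
  by apply: (capxy iP); rewrite /= inE.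
by rewrite /= inE => /eqP ->.
Qed.

Lemma unif_continuous_weak (V : uniformType) (h : V -> M) :
  (forall g, G g -> unif_continuous (g \o h : V -> R)) ->
  unif_continuous (h : V -> weak_unif G).
Proof.
move=> gh A [B [F _ <-] BA].
suff : entourage ((fun xy : V * V => (h xy.1, h xy.2)) @^-1`
    \bigcap_(i in [set` F]) (projT1 i).2) by apply: filterS => xy /BA.
rewrite preimage_bigcap; apply: filter_bigI => -[[g P] /= /asboolP[E entE EP]] _.
have Eent := gh _ (set_mem (valP g)) _ entE.
have {}Eent : entourage ((fun xy : V * V =>
  (val g (h xy.1), val g (h xy.2))) @^-1` E) by [].
by apply: (@filterS _ (@entourage V) _ _ _ _ Eent) => xy;
  exact: (EP (h xy.1, h xy.2)).
Qed.

End weak_uniformity.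

Lemma unif_continuous_comp (U V W : uniformType) (f : U -> V) (g : V -> W) :
  unif_continuous f -> unif_continuous g -> unif_continuous (g \o f).
Proof. by move=> fu gu A /gu/fu. Qed.

Lemma unif_continuous_indiscernible (R : realType) (U : uniformType)
    (h : U -> R) (v w : U) : unif_continuous h -> (forall A, entourage A -> A (v, w)) ->
  h v = h w.
Proof.
move=> hu vw; apply/eqP; rewrite -subr_eq0 -normr_le0.
apply/ler_addgt0Pr => e e0; rewrite add0r ltW //.
have : entourage [set xy : R * R | ball xy.1 e xy.2].
  by rewrite -entourage_ballE; exists e.
by move=> /hu/vw; rewrite /= -ball_normE.
Qed.

Section tangent_uniformity.
Variables (R : realType) (n : nat) (D : set 'rV[R]_n).

(** In coordinates the section is [t |-> (t, c)] with [c] constant. *)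
Lemma unif_continuous_section (v : forall t : D, tangent (Cinf_on D) t)
    (c : 'rV[R]_n) :
  (forall t i, v t (coord D i) = c 0 i) ->
  unif_continuous ((fun t : D => existT _ t (v t)) : D -> TA_unif D).
Proof.
move=> vc A [B [[B1 B2] /= [entB1 entB2] B12] BA].
suff : entourage ((fun xy : D * D =>
    (existT _ xy.1 (v xy.1), existT _ xy.2 (v xy.2))
    : TM (Cinf_on D) * TM (Cinf_on D)) @^-1` A) by [].
apply: filterS entB1 => -[x y] B1xy; apply: BA.
(* The entourage of the product is tested on a close pair in [D] and on the diagonal pair
   [(c, c)]. *)
have [[[a b] [a' b']] Bab /= E] :
    [set ((xy.1.1, xy.2.1), (xy.1.2, xy.2.2)) | xy in B]
    ((x, y), (c, c)).
  by apply: B12; split => //=; exact: entourage_refl.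
case: E Bab => -> -> -> -> Bab.
have cE t : \row_i v t (coord D i) = c by apply/rowP => i; rewrite mxE vc.
suff : B ((x, \row_i v x (coord D i)), 
    (y, \row_i v y (coord D i))) by [].
by rewrite !cE.
Qed.

Lemma TA_coord_indiscernible (v w : TM (Cinf_on D))
    (A : set (TA_unif D * TA_unif D)) :
  TA_coord v = TA_coord w -> entourage A -> A (v, w).
Proof.
move=> vw [B entB BA]; apply: BA.
suff : B (TA_coord v, TA_coord w) by [].
by rewrite vw; exact: entourage_refl.
Qed.

End tangent_uniformity.

(** * Pullback of smooth forms *)

Section smooth_pullback.
Variables (R : realType) (M N : choiceType).
Variables (C : set (M -> R)) (E : set (N -> R)) (F : M -> N).
Hypothesis hF : smooth_map C E F.

Lemma smooth_Tmap : smooth_map (TC (C := C)) (TC (C := E)) (Tmap hF).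
Proof.
apply: smooth_map_generated; first exact: generated_struct.
move=> _ [f [->|->]]; apply: sub_gen_smallest; exists (pull_fun hF f).
  by left.
by right.
Qed.

Lemma tangent_map_linear m (a : R) (x y : tangent C m) :
  tangent_map hF (a *: x + y) = a *: tangent_map hF x + tangent_map hF y.
Proof. by apply: val_inj. Qed.

Variable k : nat.

Lemma smooth_TMpow :
  smooth_map (TMpow (C := C) (k := k)) (TMpow (C := E) (k := k))
  (fun v i => Tmap hF (v i)).
Proof.
apply: smooth_map_generated; first exact: generated_struct.
move=> _ [i [f fT ->]]; apply: sub_gen_smallest.
by exists i, (f \o Tmap hF) => //; exact: smooth_Tmap.
Qed.

(** The tangent map is linear on fibres, and the map it induces on k-tuples is smooth because it
    pulls generators back to elements of the structure. *)
Lemma smooth_form_pullback (omega : Tk E k -> R) :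
  smooth_form omega -> smooth_form (pullback hF omega).
Proof.
move=> [om_lin om_smooth]; split.
  move=> m v i a x y.
  have mapE z : (fun j => tangent_map hF (dfwith v i z j)) =
      dfwith (fun j => tangent_map hF (v j)) i (tangent_map hF z).
    apply: functional_extensionality_dep => j.
    have [<-|ij] := eqVneq i j; first by rewrite !dfwithin.
    by rewrite !dfwithout.
  by rewrite /pullback /= !mapE tangent_map_linear om_lin.
pose Tkmap (w : Tk C k) : Tk E k :=
  existT _ (F (projT1 w)) (fun i => tangent_map hF (projT2 w i)).
suff : smooth_map (tauC (C := C) (k := k)) (tauC (C := E) (k := k)) Tkmap.
  exact.
apply: smooth_map_generated; first exact: generated_struct.
move=> _ [f fT <-]; apply: sub_gen_smallest.
by exists (fun v => f (fun i => Tmap hF (v i))) => //; exact: smooth_TMpow.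
Qed.

End smooth_pullback.

Lemma tangent_sumE (R : realType) (M : choiceType) (C : set (M -> R)) (m : M)
    (I : Type) (r : seq I) (v : I -> tangent C m) (f : C) :
  (\sum_(i <- r) v i) f = \sum_(i <- r) v i f.
Proof. exact: (big_morph (fun x : tangent C m => x f)). Qed.

(** * The coefficients of the pulled back form and their extension to the cube *)

Section cube.
Variables (R : realType) (M : choiceType) (C : set (M -> R)) (G : set (M -> R)).
Hypothesis GC : G `<=` C.
Variables (n : nat) (D : set 'rV[R]_n).
Hypothesis hD : dense_in D unit_cube.
Variables (phi : D -> M) (phi_smooth : smooth_map (Cinf_on D) C phi).
Hypothesis Tphi_unif : unif_continuous
  (Tmap phi_smooth : TA_unif D -> weak_unif (TG0 C G)).

(** It suffices that [phi] is uniform into [weak_unif G], which is tested on [g] in [G]: there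
    [g o phi] is [g o pi o T phi] along the zero section. *)
Lemma unif_cube_comp h : uniform_wrt G h -> unif_continuous (h \o phi).
Proof.
suff phiU : unif_continuous (phi : D -> weak_unif G).
  by move=> hU; exact: (unif_continuous_comp phiU hU).
apply: unif_continuous_weak => g Gg.
have gT : TG0 C G (g \o @TMproj R M C).
  by exists (exist _ g (mem_set (GC Gg))) => //; left.
have zeroU : unif_continuous
    ((fun t : D => existT _ t (0 : tangent (Cinf_on D) t)) : D -> TA_unif D).
  by apply: (unif_continuous_section (c := 0)) => t i; rewrite mxE.
exact: (unif_continuous_comp zeroU
  (unif_continuous_comp Tphi_unif (weak_unif_continuous gT))).
Qed.

Lemma unif_dfun_Tmap (g : C) : G (val g) ->
  unif_continuous (dfun g \o Tmap phi_smooth : TA_unif D -> R).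
Proof.
move=> Gg; apply: unif_continuous_comp Tphi_unif _.
by apply: weak_unif_continuous; exists g => //; right.
Qed.

Lemma unif_partial (g : C) l : G (val g) ->
  unif_continuous (fun t => partial hD t l (pull_fun phi_smooth g)).
Proof.
move=> Gg.
apply: (unif_continuous_comp _ (unif_dfun_Tmap Gg)
  (f := (fun t : D => existT _ t (partial hD t l)) : D -> TA_unif D)).
apply: (unif_continuous_section (c := delta_mx 0 l)) => t i.
by rewrite partial_coord mxE.
Qed.

(* Uniform continuity makes the left side depend on the coordinates of [v]
   only, so no Hadamard lemma is needed to expand [v] in the partial
   derivations. *)
Lemma tangent_expand (g : C) (t : D) (v : tangent (Cinf_on D) t) : G (val g) ->
  v (pull_fun phi_smooth g) =
  \sum_l partial hD t l (pull_fun phi_smooth g) * v (coord D l).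
Proof.
move=> Gg; pose v' := \sum_l v (coord D l) *: partial hD t l.
have v'E f : v' f = \sum_l partial hD t l f * v (coord D l).
  by rewrite tangent_sumE; apply: eq_bigr => l _; exact: mulrC.
rewrite -v'E.
apply: (unif_continuous_indiscernible (v := existT _ t v : TA_unif D)
  (w := existT _ t v') (unif_dfun_Tmap Gg)) => A.
apply: TA_coord_indiscernible; congr pair; apply/rowP => i.
rewrite !mxE -[RHS]/(v' (coord D i)) v'E (bigD1 i) // big1 => [|l li].
  by rewrite partial_coord eqxx mul1r [RHS]addr0.
by rewrite partial_coord eq_sym (negbTE li) mul0r.
Qed.

Variable k : nat.

(** By [tangent_expand] the matrix of the wedge is the Jacobian matrix of the [alpha a o phi] times
    the coordinate matrix of the vectors, and Cauchy-Binet applies. *)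
Lemma wedge_expand (alpha : 'I_k -> C) (w : Tk (Cinf_on D) k) :
  (forall a, G (val (alpha a))) ->
  wedge (fun a => dfun (alpha a)) (existT _ (phi (projT1 w))
     (fun i => tangent_map phi_smooth (projT2 w i)) : Tk C k) =
  \sum_(I : {ffun 'I_k -> 'I_n} | increasing I)
    \det (\matrix_(a, b) partial hD (Tk_base w) (I b)
            (pull_fun phi_smooth (alpha a))) *
    wedge (fun a => dfun (coord D (I a))) w.
Proof.
move=> alphaG.
pose A := \matrix_(a < k, l < n) partial hD (Tk_base w) l
            (pull_fun phi_smooth (alpha a)).
pose B := \matrix_(l < n, b < k) projT2 w b (coord D l).
transitivity (\det (A *m B)).
  congr (\det _); apply/matrixP => a b; rewrite !mxE /dfun /= tangent_expand //.
  by apply: eq_bigr => l _; rewrite !mxE.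
rewrite cauchy_binet; apply: eq_bigr => I _; congr (_ * _).
  by congr (\det _); apply/matrixP => a b; rewrite !mxE.
by congr (\det _); apply/matrixP => a b; rewrite !mxE.
Qed.

(** The local formula for [eta] holds over [U] only, but its coefficients must live on the whole
    cube to be multiplied by the extended [gamma i] and added. *)
Definition extends_to_cube (eta : Tk C k -> R) (U : set M)
    (f : {ffun 'I_k -> 'I_n} -> (unit_cube : set 'rV[R]_n) -> R) :=
  (forall I, continuous (f I)) /\
  forall w : Tk (Cinf_on D) k, U (phi (Tk_base w)) ->
    pullback phi_smooth eta w =
    pullback (smooth_set_incl hD.1) (coord_form f) w.

Lemma coord_form_inclE
    (f : {ffun 'I_k -> 'I_n} -> (unit_cube : set 'rV[R]_n) -> R) w :
  pullback (smooth_set_incl hD.1) (coord_form f) w =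
  \sum_(I : {ffun 'I_k -> 'I_n} | increasing I)
    f I (set_incl hD.1 (Tk_base w)) * wedge (fun a => dfun (coord D (I a))) w.
Proof.
apply: eq_bigr => I _; congr (_ * _); congr (\det _); apply/matrixP => a b.
by rewrite !mxE /dfun /=; congr (projT2 w b _); apply: val_inj.
Qed.

Lemma extend_local (eta : Tk C k -> R) (U : set M) p (alpha : 'I_p -> 'I_k -> C)
    (beta : 'I_p -> M -> R) :
  (forall j a, G (val (alpha j a))) -> (forall j, uniform_wrt G (beta j)) ->
  (forall w : Tk C k, U (Tk_base w) ->
     eta w = \sum_(j < p) beta j (Tk_base w) *
                           wedge (fun a => dfun (alpha j a)) w) ->
  exists f, extends_to_cube eta U f.
Proof.
move=> alphaG betaU etaE.
have /choice[B BP] j :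
    exists b : (unit_cube : set 'rV[R]_n) -> R, continuous b /\
    forall t, b (set_incl hD.1 t) = beta j (phi t).
  have [b b1 b2] := unif_continuous_extension hD (unif_cube_comp (betaU j)).
  by exists b.
have /choice[A AP] (jal : 'I_p * 'I_k * 'I_n) :
    exists b : (unit_cube : set 'rV[R]_n) -> R, continuous b /\
    forall t, b (set_incl hD.1 t) =
      partial hD t jal.2 (pull_fun phi_smooth (alpha jal.1.1 jal.1.2)).
  have [b b1 b2] := unif_continuous_extension hD
    (unif_partial jal.2 (alphaG jal.1.1 jal.1.2)).
  by exists b.
exists (fun I x => \sum_(j < p) B j x * \det (\matrix_(a, b) A (j, a, I b) x)).
split=> [I|w Uw].
  apply: continuous_sumr => j _ x; apply: (cvgM ((BP j).1 x)).
  by apply: continuous_det => a b; exact: (AP (j, a, I b)).1.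
rewrite coord_form_inclE /pullback etaE //.
under eq_bigr => j _ do rewrite (wedge_expand _ (alphaG j)) big_distrr /=.
rewrite exchange_big; apply: eq_bigr => I _ /=.
rewrite big_distrl /=; apply: eq_bigr => j _; rewrite mulrA; congr (_ * _ * _).
  by rewrite (BP j).2.
by congr (\det _); apply/matrixP => a b; rewrite !mxE (AP (j, a, I b)).2.
Qed.

Lemma extend_global (eta : Tk C k -> R) q (U : 'I_q -> set M)
    (gamma : 'I_q -> M -> R) :
  (forall i, uniform_wrt G (gamma i)) -> smooth_partition_of_unity C U gamma ->
  (forall i, exists f, extends_to_cube eta (U i) f) ->
  exists f, extends_to_cube eta setT f.
Proof.
move=> gammaU gammaP /choice[f fP].
have /choice[g gP] i :
    exists b : (unit_cube : set 'rV[R]_n) -> R, continuous b /\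
    forall t, b (set_incl hD.1 t) = gamma i (phi t).
  have [b b1 b2] := unif_continuous_extension hD (unif_cube_comp (gammaU i)).
  by exists b.
exists (fun I x => \sum_(i < q) g i x * f i I x); split=> [I|w _].
  by apply: continuous_sumr => i _ x; exact: (cvgM ((gP i).1 x) ((fP i).1 I x)).
rewrite -[LHS]mul1r -(pou_sum gammaP (phi (Tk_base w))) big_distrl /=.
rewrite coord_form_inclE.
under [RHS]eq_bigr => I _ do rewrite big_distrl /=.
rewrite exchange_big; apply: eq_bigr => i _ /=.
under [RHS]eq_bigr => I _ do rewrite -mulrA.
rewrite -big_distrr /= (gP i).2.
(* Where [gamma i] vanishes the two terms agree trivially; elsewhere the base point lies in its
   support, hence in [U i]. *)
have [->|gi0] := eqVneq (gamma i (phi (Tk_base w))) 0; first by rewrite !mul0r.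
rewrite (fP i).2; last by apply: (pou_supp gammaP); apply: subset_closure.
by rewrite coord_form_inclE.
Qed.

End cube.

Theorem theorem2 (R : realType) (M : pointedType) (C : set (M -> R))
  (hC : differential_structure C)
  (k : nat) (eta : Tk C k -> R)
  (eta_smooth : smooth_form eta) (eta_skew : skew_symmetric eta)
  (G : set (M -> R)) (hG : C = generated G)
  (q : nat) (U : 'I_q -> set M)
  (U_open : forall i, open (U i : set (weak_top C)))
  (U_cover : \bigcup_i U i = setT)
  (hi : forall i : 'I_q, exists (p : nat) (alpha : 'I_p -> 'I_k -> C)
      (beta : 'I_p -> M -> R),
    [/\ forall j a, G (val (alpha j a)),
        forall j, C (beta j) /\ uniform_wrt G (beta j)
      & forall w : Tk C k, U i (Tk_base w) ->
          eta w = \sum_(j < p) beta j (Tk_base w) *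
                               wedge (fun a => dfun (alpha j a)) w])
  (hii : exists gamma : 'I_q -> M -> R,
    smooth_partition_of_unity C U gamma /\
    forall i, uniform_wrt G (gamma i))
  (n : nat) (D : set 'rV[R]_n) (hD : dense_in D unit_cube)
  (phi : D -> M) (phi_smooth : smooth_map (Cinf_on D) C phi)
  (Tphi_unif : unif_continuous
     (Tmap phi_smooth : TA_unif D -> weak_unif (TG0 C G))) :
  smooth_form (pullback phi_smooth eta) /\
  exists omega : Tk (Cinf_on (unit_cube : set 'rV[R]_n)) k -> R,
    continuous_form omega /\
    pullback (smooth_set_incl (proj1 hD)) omega = pullback phi_smooth eta.
Proof.
have GC : G `<=` C by rewrite hG; exact: sub_gen_smallest.
split; first exact: smooth_form_pullback.
have [gamma [gammaP gammaU]] := hii.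
have [|f [fc fE]] :=
    extend_global (hD := hD) GC Tphi_unif (eta := eta) gammaU gammaP.
  move=> i; have [p [alpha [beta [alphaG betaU etaE]]]] := hi i.
  by apply: (extend_local GC hD Tphi_unif alphaG _ etaE) => j;
    have [] := betaU j.
exists (coord_form f); split; first by exists f.
by apply/funext => w; rewrite fE.
Qed.
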